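(* Let $F$ and $G$ be finite groups acting transitively on $Y=F/H$ and $X=G/K$, with $H$ the stabilizer of $y_0\in Y$ and $K$ the stabilizer of $x_0\in X$. Let $\mathcal{P}$ be a $G$-invariant partition of $X$ and $\mathcal{Q}$ an $F$-invariant partition of $Y$, and assume that $N=\{u\in F:uB=B\ \text{for all }B\in\mathcal{Q}\}$ is transitive on every $B\in\mathcal{Q}$. Let $R$ be the stabilizer of $(x_0,y_0)$ in the crested product $(F^{\mathrm{diag}}\cdot N^{\mathcal{P}})\ltimes G$ acting on $X\times Y$ by the composition action. Then the decomposition of $X\times Y$ into $R$-orbits is $$X\times Y=\left[\coprod_{i\in\mathcal{I}_0,\ j\in\mathcal{J}}\left(\Xi_i\times\Lambda_j\right)\right]\coprod\left[\coprod_{i\in\mathcal{I}\setminus\mathcal{I}_0,\ [j]\in\mathcal{J}/\sim}\left(\Xi_i\times\Lambda_{[j]}\right)\right].$$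
   Context: $X=\coprod_{i\in\mathcal{I}}\Xi_i$ is the decomposition of $X$ into $K$-orbits and $Y=\coprod_{j\in\mathcal{J}}\Lambda_j$ the decomposition of $Y$ into $H$-orbits. A partition of a $G$-set is $G$-invariant if $x\sim_{\mathcal P}x'$ implies $gx\sim_{\mathcal P}gx'$ for all $g\in G$, where $\sim_{\mathcal P}$ is the associated equivalence relation. $A_0$ is the part of $\mathcal{P}$ containing $x_0$; it is a union of $K$-orbits, and $\mathcal{I}_0\subseteq\mathcal{I}$ is defined by $A_0=\coprod_{i\in\mathcal{I}_0}\Xi_i$. $B_0$ is the part of $\mathcal{Q}$ containing $y_0$ and $S=\{s\in F:sB_0=B_0\}$. On $\mathcal{J}$ define $i\sim j$ if there exists $s\in S$ with $\Lambda_i\cap s\Lambda_j\neq\emptyset$; this is an equivalence relation, $[j]$ is the class of $j$, and $\Lambda_{[j]}=\coprod_{i\in[j]}\Lambda_i$. The wreath product $F\wr G=F^X\ltimes G$ is the set of pairs $(f,g)$, $f:X\to F$, $g\in G$, with $(f,g)(f_1,g_1)=(f\cdot gf_1,gg_1)$, $(f\cdot gf_1)(x)=f(x)f_1(g^{-1}x)$. It acts on $X\times Y$ by the composition action $(f,g)(x,y)=(gx,f(gx)y)$. $F^{\mathrm{diag}}$ is the group of constant functions $X\to F$, $N^{\mathcal{P}}$ the group of functions $X\to N$ that are constant on each part of $\mathcal{P}$; $F^{\mathrm{diag}}\cdot N^{\mathcal{P}}$ is a subgroup of $F^X$. The crested product of $F$ by $G$ (with respect to $\mathcal{P}$ and $\mathcal{Q}$)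 is the subgroup $(F^{\mathrm{diag}}\cdot N^{\mathcal{P}})\ltimes G=\{(f,g)\in F\wr G: f\in F^{\mathrm{diag}}\cdot N^{\mathcal{P}}\}$ of $F\wr G$. *)

(* Defs.v *)
From HB Require Import structures.
From mathcomp Require Import all_boot all_fingroup.

Set Implicit Arguments.
Unset Strict Implicit.
Unset Printing Implicit Defensive.

Import GroupScope.

Record left_action (G : finGroupType) (T : finType) := LeftAction {
  lact :> G -> T -> T;
  lact1 : forall x, lact 1 x = x;
  lactM : forall g h x, lact (g * h) x = lact g (lact h x)
}.

(* MathComp actions are right actions; a left action is turned into the right
   action (x, g) |-> g^-1 x. A subgroup has the same orbits and stabilisers for
   both, so the library notions can be used through this conversion. *)
Definition act_of_left_fun (G : finGroupType) (T : finType) (a : left_action G T)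
  (x : T) (g : G) : T := a g^-1 x.

Fact act_of_left_fun1 (G : finGroupType) (T : finType) (a : left_action G T) :
  (act_of_left_fun a)^~ 1 =1 id.
Proof. by move=> x; rewrite /act_of_left_fun invg1 lact1. Qed.

Fact act_of_left_funM (G : finGroupType) (T : finType) (a : left_action G T) (x : T) :
  act_morph (act_of_left_fun a) x.
Proof. by move=> g h; rewrite /act_of_left_fun invMg lactM. Qed.

Definition act_of_left (G : finGroupType) (T : finType) (a : left_action G T) :
  {action G &-> T} := TotalAction (act_of_left_fun1 a) (@act_of_left_funM G T a).

Definition orbit_decomposition (G : finGroupType) (T : finType)
    (a : left_action G T) (A : {set G}) (I : finType) (E : I -> {set T}) : Prop :=
  [/\ \bigcup_i E i = [set: T],
      forall i j, i != j -> [disjoint E i & E j]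
    & forall i, exists x, E i = orbit (act_of_left a) A x].

Definition invariant_partition (G : finGroupType) (T : finType)
    (a : left_action G T) (P : {set {set T}}) : Prop :=
  partition P [set: T] /\
  forall g x x', x' \in pblock P x -> a g x' \in pblock P (a g x).

Definition parts_kernel (G : finGroupType) (T : finType)
    (a : left_action G T) (Q : {set {set T}}) : {set G} :=
  [set u | [forall B in Q, a u @: B == B]].

Definition part_stab (G : finGroupType) (T : finType)
    (a : left_action G T) (B : {set T}) : {set G} :=
  [set s | a s @: B == B].

(* The library makes this type a group under the pointwise product. *)
Notation fun_group F X := {dffun forall _ : X, F}.

(* The phantom argument a attaches the group law to the type. *)
Record wreath (F G : finGroupType) (X : finType) (a : left_action G X) :=
  Wreath { base : fun_group F X; top : G }.
Arguments Wreath {F G X} a base top.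

Section WreathGroup.
Variables (F G : finGroupType) (X : finType) (aX : left_action G X).
Local Notation W := (wreath F aX).
Implicit Types (f : fun_group F X) (g : G) (u v w : W).

Definition shift g f : fun_group F X := [ffun x => f (aX g^-1 x)].

Definition wreath_to_pair w := (base w, top w).
Definition pair_to_wreath (p : fun_group F X * G) : W := Wreath aX p.1 p.2.
Fact wreath_to_pairK : cancel wreath_to_pair pair_to_wreath.
Proof. by case. Qed.

HB.instance Definition _ := Finite.copy W (can_type wreath_to_pairK).

Definition wreath_mul u v : W :=
  Wreath aX (base u * shift (top u) (base v)) (top u * top v).
Definition wreath_one : W := Wreath aX 1 1.
Definition wreath_inv u : W :=
  Wreath aX (shift (top u)^-1 (base u)^-1) (top u)^-1.

Fact wreath_mulA : associative wreath_mul.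
Proof.
move=> [f1 g1] [f2 g2] [f3 g3]; rewrite /wreath_mul /=; congr Wreath; last exact: mulgA.
by apply/ffunP=> x; rewrite !ffunE mulgA invMg lactM.
Qed.

Fact wreath_mul1 : left_id wreath_one wreath_mul.
Proof.
move=> [f g]; rewrite /wreath_mul /=; congr Wreath; last exact: mul1g.
by apply/ffunP=> x; rewrite !ffunE mul1g invg1 lact1.
Qed.

Fact wreath_mulV : left_inverse wreath_one wreath_inv wreath_mul.
Proof.
move=> [f g]; rewrite /wreath_mul /wreath_one /=; congr Wreath; last exact: mulVg.
by apply/ffunP=> x; rewrite !ffunE invgK mulVg.
Qed.

HB.instance Definition _ :=
  Finite_isGroup.Build W wreath_mulA wreath_mul1 wreath_mulV.

Variables (Y : finType) (aY : left_action F Y).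

Definition comp_lact w (p : X * Y) : X * Y :=
  (aX (top w) p.1, aY (base w (aX (top w) p.1)) p.2).

Fact comp_lact1 p : comp_lact 1 p = p.
Proof. by case: p => x y; rewrite /comp_lact /= ffunE !lact1. Qed.

Fact comp_lactM u v p : comp_lact (u * v) p = comp_lact u (comp_lact v p).
Proof.
case: p => x y; rewrite /comp_lact /= !ffunE /= !lactM.
by rewrite -(lactM aX (top u)^-1) mulVg lact1.
Qed.

Definition composition_action : left_action W (X * Y)%type :=
  LeftAction comp_lact1 comp_lactM.

End WreathGroup.

Definition diag_group (F : finGroupType) (X : finType) : {set fun_group F X} :=
  [set f : fun_group F X | [forall x, forall x', f x == f x']].

Definition block_group (F : finGroupType) (X : finType) (N : {set F})
    (P : {set {set X}}) : {set fun_group F X} :=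
  [set f : fun_group F X | [forall x, f x \in N] &&
     [forall A in P, forall x in A, forall x' in A, f x == f x']].

Definition crested (F G : finGroupType) (X Y : finType) (aX : left_action G X)
    (aY : left_action F Y) (P : {set {set X}}) (Q : {set {set Y}}) :
    {set wreath F aX} :=
  [set w | base w \in diag_group F X * block_group (parts_kernel aY Q) P].

Definition orbit_rel (G : finGroupType) (T : finType) (a : left_action G T)
    (S : {set G}) (J : finType) (L : J -> {set T}) : rel J :=
  fun i j => [exists s in S, L i :&: a s @: L j != set0].

Section CrestedGroup.
Variables (F G : finGroupType) (X Y : finType).
Variables (aX : left_action G X) (aY : left_action F Y).
Variables (P : {set {set X}}) (Q : {set {set Y}}).
Hypotheses (hP : invariant_partition aX P) (hQ : invariant_partition aY Q).
Local Notation N := (parts_kernel aY Q).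

Fact mem_parts_kernel u :
  (u \in N) = [forall y, aY u y \in pblock Q y].
Proof.
have [/and3P [/eqP covQ tQ _] _] := hQ.
have inQ y : y \in cover Q by rewrite covQ inE.
apply/idP/forallP => [|hu].
  rewrite inE => /forall_inP hu y.
  rewrite -(eqP (hu _ (pblock_mem (inQ y)))); apply: imset_f.
  by rewrite mem_pblock.
rewrite inE; apply/forall_inP=> B BQ; rewrite eqEcard; apply/andP; split.
  apply/subsetP=> _ /imsetP [y yB ->].
  by rewrite -(def_pblock tQ BQ yB).
rewrite card_imset //; apply: can_inj (aY u^-1) _ => y.
by rewrite -lactM mulVg lact1.
Qed.

Fact crested_group_set : group_set (crested aX aY P Q).
Proof.
have [/and3P [/eqP covQ tQ _] iQ] := hQ.
have [/and3P [/eqP covP tP _] iP] := hP.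
have N1 : 1 \in N.
  by rewrite mem_parts_kernel; apply/forallP=> y; rewrite lact1 mem_pblock covQ inE.
have NM u v : u \in N -> v \in N -> u * v \in N.
  rewrite !mem_parts_kernel => /forallP hu /forallP hv; apply/forallP=> y.
  by rewrite lactM -(same_pblock tQ (hv y)).
have NJ c u : u \in N -> u ^ c \in N.
  rewrite !mem_parts_kernel => /forallP hu; apply/forallP=> y.
  rewrite conjgE !lactM.
  have := iQ c^-1 _ _ (hu (aY c y)).
  by rewrite -[in pblock _ _]lactM mulVg lact1.
pose D := diag_group F X; pose B := block_group N P.
have gD : group_set D.
  apply/group_setP; split=> [|f h].
    by rewrite inE; apply/forallP=> x; apply/forallP=> x'; rewrite !ffunE.
  rewrite !inE => /forallP hf /forallP hh.
  apply/forallP=> x; apply/forallP=> x'; rewrite !ffunE.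
  by rewrite (eqP (forallP (hf x) x')) (eqP (forallP (hh x) x')).
have BP (f : fun_group F X) : reflect ((forall x, f x \in N) /\
    forall x x', x' \in pblock P x -> f x = f x') (f \in B).
  rewrite inE; apply: (iffP andP) => [[/forallP h1 h2]|[h1 h2]]; split=> //.
  - move=> x x' xx'; apply/eqP.
    have xc : x \in cover P by rewrite covP inE.
    move/forall_inP: h2 => /(_ _ (pblock_mem xc)) /forall_inP /(_ x).
    rewrite mem_pblock => /(_ xc) /forall_inP; exact.
  - exact/forallP.
  - apply/forall_inP=> A AP; apply/forall_inP=> x xA; apply/forall_inP=> x' x'A.
    by apply/eqP/h2; rewrite (def_pblock tP AP xA).
have gB : group_set B.
  apply/group_setP; split=> [|f h].
    by apply/BP; split=> [x|x x' _]; rewrite !ffunE.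
  move=> /BP [f1 f2] /BP [h1 h2]; apply/BP; split=> [x|x x' xx'].
    by rewrite ffunE NM.
  by rewrite !ffunE (f2 _ _ xx') (h2 _ _ xx').
have DB : Group gD \subset 'N(Group gB).
  apply/subsetP=> f fD; rewrite inE; apply/subsetP=> _ /imsetP [h hB ->].
  move: fD; rewrite inE => /forallP hf; case/BP: hB => h1 h2.
  apply/BP; split=> [x|x x' xx']; rewrite !ffunE.
    exact: NJ.
  by rewrite (h2 _ _ xx') (eqP (forallP (hf x) x')).
have sD g (f : fun_group F X) : f \in D -> shift aX g f \in D.
  rewrite !inE => /forallP hf; apply/forallP=> x; apply/forallP=> x'.
  by rewrite !ffunE; apply: (forallP (hf _)).
have sB g (f : fun_group F X) : f \in B -> shift aX g f \in B.
  case/BP=> h1 h2; apply/BP; split=> [x|x x' xx']; rewrite !ffunE //.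
  exact/h2/iP.
have DBE : Group gD <*> Group gB = D * B by exact: norm_joinEl.
have shiftM g (f h : fun_group F X) :
    shift aX g (f * h) = shift aX g f * shift aX g h.
  by apply/ffunP=> x; rewrite !ffunE.
have DBM (f h : fun_group F X) : f \in D * B -> h \in D * B -> f * h \in D * B.
  by rewrite -DBE; apply: groupM.
apply/group_setP; split=> [|u v]; rewrite !inE -/D -/B.
  by rewrite -DBE; apply: group1.
move=> uC /mulsgP [d b dD bB vE].
apply: (DBM (base u) (shift aX (top u) (base v))) => //.
by rewrite vE shiftM; apply: mem_mulg; [apply: sD | apply: sB].
Qed.
End CrestedGroup.

(* Main.v *)
Require Import Defs.
From mathcomp Require Import all_boot all_fingroup.

(** Write H and K for the stabilisers of y0 and x0, A0 and B0 for the parts of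
    x0 and y0, and S for the stabiliser of B0. An element (f, g) of the crested
    product fixes (x0, y0) exactly when g lies in K and f x0 lies in H, and it
    sends (x, y) to (g x, f (g x) y), where f = d * n with d constant and n an
    N-valued function constant on the parts of P. What has to be determined is
    which values f (g x) can take once g is fixed.

    If x lies in A0, so does g x, because K preserves A0; since f is constant on
    A0, f (g x) = f x0 is in H. Constant functions realise every value in H, so
    the orbit is K x times H y ([orbit_in_part]).

    If x lies outside A0, so does g x, and f (g x) = f x0 * (n x0)^-1 * n (g x)
    lies in H N. Functions h on A0, h n off A0 realise every element of H N.
    Now S = H N: the inclusion of H and N in S is clear, and conversely the
    transitivity of N on B0 lets one correct any s in S by an element of N so
    that it fixes y0 ([part_stab_factor]). Hence the orbit is K x times S y
    ([orbit_off_part]).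

    Finally, an S-orbit in Y is a union of H-orbits, and two H-orbits are
    related by ~ exactly when they lie in the same S-orbit ([orbit_relE]); so ~
    is an equivalence and its classes are the S-orbits ([bigcup_class]). *)


Set Implicit Arguments.
Unset Strict Implicit.
Unset Printing Implicit Defensive.

Import GroupScope.

(** * Orbits and stabilisers of left actions *)

Section LeftAction.
Variables (G : finGroupType) (T : finType) (a : left_action G T).
Implicit Types (A : {group G}) (B : {set T}) (Q : {set {set T}}).

Lemma lactK g : cancel (a g) (a g^-1).
Proof. by move=> x; rewrite -lactM mulVg lact1. Qed.

Lemma lactKV g : cancel (a g^-1) (a g).
Proof. by move=> x; rewrite -lactM mulgV lact1. Qed.

(** Inversion permutes a subgroup, so the conversion to a right action is
    invisible on orbits; likewise for stabilisers below. *)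
Lemma mem_orbit_left A x y :
  reflect (exists2 g, g \in A & y = a g x) (y \in orbit (act_of_left a) A x).
Proof.
apply: (iffP orbitP) => -[g gA e].
  by exists g^-1; rewrite ?groupV // -e.
by exists g^-1; rewrite ?groupV // e /= /act_of_left_fun invgK.
Qed.

Lemma mem_astab1_left g x : (g \in 'C[x | act_of_left a]) = (a g x == x).
Proof.
rewrite -groupV; apply/astab1P/eqP => /=;
  by rewrite /act_of_left_fun invgK.
Qed.

Lemma mem_part_stab B g : g \in part_stab a B -> forall x, x \in B -> a g x \in B.
Proof. by rewrite inE => /eqP eB x xB; rewrite -[in X in _ \in X]eB imset_f. Qed.

(** B is finite and g acts injectively, so an inclusion g B <= B is an equality. *)
Lemma part_stabI B g : (forall x, x \in B -> a g x \in B) -> g \in part_stab a B.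
Proof.
move=> gB; rewrite inE eqEcard card_imset ?leqnn ?andbT; last exact: can_inj (lactK g).
by apply/subsetP=> _ /imsetP [x xB ->]; apply: gB.
Qed.

Fact part_stab_group_set B : group_set (part_stab a B).
Proof.
apply/group_setP; split=> [|g h gB hB]; apply: part_stabI => x xB.
  by rewrite lact1.
by rewrite lactM; apply: (mem_part_stab gB); apply: (mem_part_stab hB).
Qed.

Canonical part_stab_group B := Group (part_stab_group_set B).

Lemma parts_kernelE Q : parts_kernel a Q = \bigcap_(B in Q) part_stab a B.
Proof.
apply/setP=> u; rewrite inE.
by apply/forall_inP/bigcapP => h B /h; rewrite inE.
Qed.

Fact parts_kernel_group_set Q : group_set (parts_kernel a Q).
Proof. by rewrite parts_kernelE; apply: groupP. Qed.

Canonical parts_kernel_group Q := Group (parts_kernel_group_set Q).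

Section Part.
Variables (Q : {set {set T}}) (y0 : T).
Hypothesis hQ : invariant_partition a Q.
Local Notation B0 := (pblock Q y0).

Lemma mem_invariant_pblock x : x \in pblock Q x.
Proof. by case: hQ => /and3P [/eqP covQ _ _] _; rewrite mem_pblock covQ inE. Qed.

Lemma invariant_pblock_mem x : pblock Q x \in Q.
Proof. by case: hQ => /and3P [/eqP covQ _ _] _; rewrite pblock_mem // covQ inE. Qed.

Lemma eq_invariant_pblock x y : y \in pblock Q x -> pblock Q y = pblock Q x.
Proof. by case: hQ => /and3P [_ tQ _] _ /(same_pblock tQ). Qed.

Lemma stab_sub_part_stab : 'C[y0 | act_of_left a] \subset part_stab a B0.
Proof.
apply/subsetP=> h; rewrite mem_astab1_left => /eqP hy0.
apply: part_stabI => y yB; case: (hQ) => _ /(_ h _ _ yB).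
by rewrite hy0.
Qed.

Lemma parts_kernel_sub_part_stab : parts_kernel a Q \subset part_stab a B0.
Proof. by rewrite parts_kernelE bigcap_inf ?invariant_pblock_mem. Qed.

(** The only use of the transitivity of N on the parts: it moves y0 to
    s^-1 y0 inside B0, which turns s into an element fixing y0. *)
Lemma part_stab_factor :
    [transitive parts_kernel a Q, on B0 | act_of_left a] ->
  part_stab a B0 = 'C[y0 | act_of_left a] * parts_kernel a Q.
Proof.
move=> trN; apply/eqP; rewrite eqEsubset mul_subG ?stab_sub_part_stab //; last first.
  exact: parts_kernel_sub_part_stab.
rewrite andbT; apply/subsetP=> s sS.
have sy : a s^-1 y0 \in B0.
  by apply: mem_part_stab (mem_invariant_pblock y0); rewrite groupV.
have := sy; rewrite -{1}(atransP trN _ (mem_invariant_pblock y0)).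
case/mem_orbit_left=> n nN e; apply/mulsgP.
exists (s * n) n^-1; rewrite ?groupV ?mulgK //.
by rewrite mem_astab1_left lactM -e lactKV.
Qed.

End Part.

(** * Grouping the orbits of a subgroup into the orbits of a larger group *)

Section OrbitRel.
Variables (A S : {group G}) (J : finType) (L : J -> {set T}).
Hypotheses (sAS : A \subset S) (hL : orbit_decomposition a A L).

Lemma decomposition_inj i j x : x \in L i -> x \in L j -> i = j.
Proof.
case: hL => _ dL _ xi xj; apply/eqP; apply: contraLR xj => /dL.
by move/pred0P/(_ x) => /=; rewrite xi => /= ->.
Qed.

Lemma decomposition_orbit i x : x \in L i -> L i = orbit (act_of_left a) A x.
Proof. by case: hL => _ _ /(_ i) [y ->] /orbit_eqP. Qed.

Lemma decomposition_cover x : exists i, x \in L i.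
Proof.
case: hL => cL _ _; have : x \in \bigcup_i L i by rewrite cL inE.
by case/bigcupP=> i _ xi; exists i.
Qed.

(** Since A is contained in S, the S-orbit of a point of L i depends on i
    alone. This form makes it evident that the relation is an equivalence. *)
Lemma orbit_relE i j x y : x \in L i -> y \in L j ->
  orbit_rel a S L i j = (x \in orbit (act_of_left a) S y).
Proof.
move=> xi yj; apply/exists_inP/mem_orbit_left.
  case=> s sS /set0Pn [z /setIP [zi /imsetP [t tj ez]]].
  move: zi tj; rewrite (decomposition_orbit xi) (decomposition_orbit yj).
  case/mem_orbit_left=> g gA eg /mem_orbit_left [h hA eh].
  exists (g^-1 * s * h); first by rewrite !groupM ?groupV // (subsetP sAS).
  by rewrite 2!lactM -eh -ez eg lactK.
case=> s sS e; exists s => //; apply/set0Pn; exists x.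
by rewrite inE xi e imset_f.
Qed.

Lemma orbit_rel_equiv :
  {in [set: J] & &, equivalence_rel (orbit_rel a S L)}.
Proof.
have ne i : exists x, x \in L i.
  by case: hL => _ _ /(_ i) [x ->]; exists x; apply: orbit_refl.
move=> i j k _ _ _; have [[[x xi] [y yj]] [z zk]] := (ne i, ne j, ne k).
rewrite (orbit_relE zk zk) orbit_refl; split=> //.
rewrite (orbit_relE xi yj) (orbit_relE xi zk) (orbit_relE yj zk).
by move=> /orbit_eqP e; rewrite orbit_sym e orbit_sym.
Qed.

Local Notation classes := (equivalence_partition (orbit_rel a S L) [set: J]).

(** The L i cover T and i lies in c exactly when L i lies in S x, by
    [orbit_relE]; hence the union over c is all of S x. *)
Lemma bigcup_class (c : {set J}) j x : c \in classes -> j \in c -> x \in L j ->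
  \bigcup_(i in c) L i = orbit (act_of_left a) S x.
Proof.
have /and3P [_ tC _] := equivalence_partitionP orbit_rel_equiv.
move=> cC jc xj; apply/setP=> y; have [i yi] := decomposition_cover y.
rewrite orbit_sym -(orbit_relE xj yi).
have -> : orbit_rel a S L j i = (i \in c).
  rewrite -(def_pblock tC cC jc).
  by rewrite pblock_equivalence_partition ?inE //; apply: orbit_rel_equiv.
apply/bigcupP/idP => [[k kc yk]|ic]; last by exists i.
by rewrite (decomposition_inj yi yk).
Qed.

Lemma class_inj (c d : {set J}) j :
  c \in classes -> d \in classes -> j \in c -> j \in d -> c = d.
Proof.
have /and3P [_ tC _] := equivalence_partitionP orbit_rel_equiv.
by move=> cC dC jc jd; rewrite -(def_pblock tC cC jc) (def_pblock tC dC jd).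
Qed.

Lemma mem_class j : exists2 c : {set J}, c \in classes & j \in c.
Proof.
have /and3P [/eqP cov _ _] := equivalence_partitionP orbit_rel_equiv.
have : j \in cover classes by rewrite cov inE.
by case/bigcupP=> c; exists c.
Qed.

Lemma class_neq0 (c : {set J}) : c \in classes -> exists j, j \in c.
Proof.
have /and3P [_ _ n0] := equivalence_partitionP orbit_rel_equiv.
by move=> cC; apply/set0Pn; apply: contraNneq n0 => <-.
Qed.

End OrbitRel.
End LeftAction.

(** * Orbits of a point stabiliser in the crested product *)

Section Crested.
Variables (F G : finGroupType) (X Y : finType).
Variables (aX : left_action G X) (aY : left_action F Y) (x0 : X) (y0 : Y).
Variables (P : {set {set X}}) (Q : {set {set Y}}).
Hypotheses (hP : invariant_partition aX P) (hQ : invariant_partition aY Q).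

Local Notation K := 'C[x0 | act_of_left aX].
Local Notation H := 'C[y0 | act_of_left aY].
Local Notation N := (parts_kernel aY Q).
Local Notation S := (part_stab aY (pblock Q y0)).
Local Notation A0 := (pblock P x0).
Local Notation aXY := (composition_action aX aY).
Local Notation R := 'C_(crested aX aY P Q)[(x0, y0) | act_of_left aXY].
Local Notation orb a A x := (orbit (act_of_left a) A x).

(** The constant factor is recorded by its single value d, which lets the two
    orbit computations work with values in F instead of finite functions. *)
Lemma crestedP (w : wreath F aX) :
  reflect (exists (d : F) (n : X -> F),
      [/\ forall x, n x \in N, forall x x', x' \in pblock P x -> n x = n x'
        & forall x, base w x = d * n x])
    (w \in crested aX aY P Q).
Proof.
have [/and3P [_ tP _] _] := hP.
rewrite inE; apply: (iffP mulsgP) => [[d n]|[d [n [nN nP e]]]].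
  rewrite !inE => /forallP dc /andP [/forallP nN nP] e.
  exists (d x0), n; split=> // [x x' xx'|x]; last first.
    by rewrite e ffunE (eqP (forallP (dc x0) x)).
  move/forall_inP: nP => /(_ _ (invariant_pblock_mem hP x)) /forall_inP.
  move=> /(_ _ (mem_invariant_pblock hP x)) /forall_inP /(_ _ xx').
  by move/eqP.
exists [ffun _ => d] [ffun x => n x].
- by rewrite inE; apply/forallP=> x; apply/forallP=> x'; rewrite !ffunE.
- rewrite inE; apply/andP; split; first by apply/forallP=> x; rewrite ffunE.
  apply/forall_inP=> A AP; apply/forall_inP=> x xA; apply/forall_inP=> x' x'A.
  by rewrite !ffunE; apply/eqP/nP; rewrite (def_pblock tP AP xA).
- by apply/ffunP=> x; rewrite !ffunE e.
Qed.

Lemma mem_crested_stab (w : wreath F aX) :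
  (w \in R) = [&& w \in crested aX aY P Q, top w \in K & base w x0 \in H].
Proof.
rewrite in_setI !mem_astab1_left /= /comp_lact /= xpair_eqE.
by case: (aX (top w) x0 =P x0) => [->|].
Qed.

Fact crested_stab_group_set : group_set R.
Proof. exact: (groupP (Group (crested_group_set hP hQ) :&: _)). Qed.

Lemma mem_crested_orbit p q :
  reflect (exists2 w, w \in R & q = aXY w p) (q \in orb aXY R p).
Proof. exact: (mem_orbit_left aXY (Group crested_stab_group_set)). Qed.

Lemma mem_part_lact g x : g \in K -> x \in A0 -> aX g x \in A0.
Proof. by move=> gK; apply: mem_part_stab; apply: (subsetP (stab_sub_part_stab x0 hP)). Qed.

(** x and g x both lie in A0, where the base function is constant, so the same
    element of H that fixes y0 in the fibre over x0 also moves y. *)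
Lemma orbit_in_part x y : x \in A0 -> orb aXY R (x, y) = setX (orb aX K x) (orb aY H y).
Proof.
move=> xA; apply/setP=> -[x' y']; rewrite in_setX.
apply/mem_crested_orbit/andP.
  case=> w; rewrite mem_crested_stab => /and3P [/crestedP [d [n [nN nP e]]] gK fH].
  case=> -> ->; split; apply/mem_orbit_left; first by exists (top w).
  exists (base w x0) => //; congr (aY _ _); rewrite !e.
  by rewrite -(nP x0) // mem_part_lact.
case=> /mem_orbit_left [g gK ->] /mem_orbit_left [h hH ->].
exists (Wreath aX [ffun _ => h] g); last by rewrite /= /comp_lact /= ffunE.
rewrite mem_crested_stab /= ffunE gK hH !andbT; apply/crestedP.
by exists h, (fun _ => 1); split=> // x1; rewrite ?group1 // ffunE mulg1.
Qed.

Hypothesis trN : [transitive N, on pblock Q y0 | act_of_left aY].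

(** Off A0 the N-valued factor is free from its value on A0, and this freedom
    enlarges the group acting on the second coordinate from H to H N = S. *)
Lemma orbit_off_part x y : x \notin A0 -> orb aXY R (x, y) = setX (orb aX K x) (orb aY S y).
Proof.
move=> xA; apply/setP=> -[x' y']; rewrite in_setX.
apply/mem_crested_orbit/andP.
  case=> w; rewrite mem_crested_stab => /and3P [/crestedP [d [n [nN nP e]]] gK fH].
  case=> -> ->; split; apply/mem_orbit_left; first by exists (top w).
  exists (base w (aX (top w) x)) => //.
  rewrite /= (part_stab_factor hQ trN); apply/mulsgP.
  (* d * n (g x) = (d * n x0) * (n x0)^-1 * n (g x), and d * n x0 fixes y0. *)
  exists (base w x0) ((n x0)^-1 * n (aX (top w) x)) => //.
    by rewrite groupM ?groupV.
  by rewrite !e mulgA mulgK.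
case=> /mem_orbit_left [g gK ->] /mem_orbit_left [s]; rewrite /= (part_stab_factor hQ trN).
case/mulsgP=> h n hH nN -> ->.
have gxA : aX g x \notin A0.
  by apply: contra xA => gx; rewrite -(lactK aX g x) mem_part_lact ?groupV.
(* Being 1 on A0, the N-valued factor leaves the value h at x0, as fixing y0
   requires; at g x, outside A0, the value is the prescribed h * n. *)
exists (Wreath aX [ffun x1 => h * (if x1 \in A0 then 1 else n)] g); last first.
  by rewrite /= /comp_lact /= ffunE (negbTE gxA).
rewrite mem_crested_stab /= ffunE (mem_invariant_pblock hP) mulg1 gK hH !andbT.
apply/crestedP; exists h, (fun x1 => if x1 \in A0 then 1 else n).
split=> [x1|x1 x2 x12|x1]; last by rewrite ffunE.
  by case: ifP.
have [/and3P [/eqP covP tP _] _] := hP.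
(* Membership in A0 depends only on the part of the point. *)
by rewrite -!(eq_pblock _ tP) ?covP ?inE // (eq_invariant_pblock hP x12).
Qed.

End Crested.

(** * The orbit decomposition *)

Theorem theorem4p7 (F G : finGroupType) (X Y : finType)
    (aX : left_action G X) (aY : left_action F Y) (x0 : X) (y0 : Y)
    (transX : [transitive [set: G], on [set: X] | act_of_left aX])
    (transY : [transitive [set: F], on [set: Y] | act_of_left aY])
    (I J : finType) (Xi : I -> {set X}) (Lambda : J -> {set Y})
    (hXi : orbit_decomposition aX 'C[x0 | act_of_left aX] Xi)
    (hLambda : orbit_decomposition aY 'C[y0 | act_of_left aY] Lambda)
    (P : {set {set X}}) (Q : {set {set Y}})
    (hP : invariant_partition aX P) (hQ : invariant_partition aY Q)
    (hN : forall B : {set Y}, B \in Q ->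
       [transitive parts_kernel aY Q, on B | act_of_left aY])
    (I0 : {set I}) (hI0 : pblock P x0 = \bigcup_(i in I0) Xi i) :
  let sim := orbit_rel aY (part_stab aY (pblock Q y0)) Lambda in
  let classes_J := equivalence_partition sim [set: J] in
  let R := 'C_(crested aX aY P Q)[(x0, y0) | act_of_left (composition_action aX aY)] in
  orbit_decomposition (composition_action aX aY) R
    (fun k : {i : I | i \in I0} * J
             + {i : I | i \notin I0} * {c : {set J} | c \in classes_J} =>
       match k with
       | inl (i, j) => setX (Xi (val i)) (Lambda j)
       | inr (i, c) => setX (Xi (val i)) (\bigcup_(j in val c) Lambda j)
       end).
Proof.
move=> sim classes_J R.
have sHS := stab_sub_part_stab y0 hQ.
have trN := hN _ (invariant_pblock_mem hQ y0).
(* The cases of the two families of blocks are those of the two orbit lemmas. *)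
have mem_I0 i x : x \in Xi i -> (x \in pblock P x0) = (i \in I0).
  move=> xi; rewrite hI0; apply/bigcupP/idP => [[j jI0 xj]|iI0]; last by exists i.
  by rewrite (decomposition_inj hXi xi xj).
have ne_Xi i : exists x, x \in Xi i.
  by case: hXi => _ _ /(_ i) [x ->]; exists x; apply: orbit_refl.
have ne_Lambda j : exists y, y \in Lambda j.
  by case: hLambda => _ _ /(_ j) [y ->]; exists y; apply: orbit_refl.
split.
- apply/setP=> -[x y]; rewrite inE; apply/bigcupP.
  have [i xi] := decomposition_cover hXi x.
  have [j yj] := decomposition_cover hLambda y.
  have [iI0|iI0] := boolP (i \in I0).
    by exists (inl (Sub i iI0, j)); rewrite // in_setX SubK xi.
  have [c cC jc] := mem_class sHS hLambda j.
  exists (inr (Sub i iI0, Sub c cC)); rewrite // in_setX !SubK xi /=.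
  by apply/bigcupP; exists j.
(* A common point (x, y) pins down i and j, and j pins down its class. *)
- move=> k k' kk'; rewrite -setI_eq0; apply: contraR kk' => /set0Pn [[x y]].
  rewrite inE.
  case: k => [[[i Hi] j]|[[i Hi] [c Hc]]]; case: k' => [[[i' Hi'] j']|[[i' Hi'] [c' Hc']]];
    rewrite !in_setX /= => /andP [/andP [xi yj] /andP [xi' yj']];
    have ei := decomposition_inj hXi xi xi'; subst i'.
  + have ej := decomposition_inj hLambda yj yj'; subst j'.
    by rewrite (bool_irrelevance Hi Hi').
  + by case: (negP Hi' Hi).
  + by case: (negP Hi Hi').
  + case/bigcupP: yj => j jc yj; case/bigcupP: yj' => j' jc' yj'.
    have ej := decomposition_inj hLambda yj yj'; subst j'.
    have ec := class_inj sHS hLambda Hc Hc' jc jc'; subst c'.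
    by rewrite (bool_irrelevance Hi Hi') (bool_irrelevance Hc Hc').
case=> [[[i Hi] j]|[[i Hi] [c Hc]]] /=; have [x xi] := ne_Xi i.
  have [y yj] := ne_Lambda j; exists (x, y).
  rewrite orbit_in_part ?(mem_I0 i) //.
  by rewrite (decomposition_orbit hXi xi) (decomposition_orbit hLambda yj).
have [j jc] := class_neq0 sHS hLambda Hc; have [y yj] := ne_Lambda j; exists (x, y).
rewrite orbit_off_part ?(mem_I0 i) //.
by rewrite (decomposition_orbit hXi xi) (bigcup_class sHS hLambda Hc jc yj).
Qed.
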